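(* Let $A\in\mathbb{R}^{n\times n}$, $B\in\mathbb{R}^{n\times p}$, $C\in\mathbb{R}^{q\times n}$, and suppose $\Theta\in\mathrm{SPD}(n)$ satisfies the Lyapunov inequality $A^{\tau}\Theta+\Theta A\prec 0$. Let $k\le n$, let $N\in\mathrm{SPD}(k)$, and let the reduced-order model $(\tilde A,\tilde B,\tilde C)$ be constructed from $(A,B,C)$ by inner-product projection with $M=\Theta$, i.e. $\Phi\in O(M,N)$, $\Psi=M\Phi N^{-1}$, $\tilde A=\Psi^{\tau}A\Phi$, $\tilde B=\Psi^{\tau}B$, $\tilde C=C\Phi$. Then $(\tilde A,\tilde B,\tilde C)$ is asymptotically stable with Lyapunov matrix $N$, i.e. $\tilde A^{\tau}N+N\tilde A\prec 0$ and every solution of $\dot z=\tilde A z$ is bounded on $t\ge 0$ and tends to $0$ as $t\to\infty$.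
   Context: $\mathrm{SPD}(n)$ is the set of real symmetric positive-definite $n\times n$ matrices; $X\prec 0$ means the symmetric matrix $X$ is negative definite; $\tau$ denotes transpose. For $M\in\mathrm{SPD}(n)$, $N\in\mathrm{SPD}(k)$, $k\le n$, $O(M,N)$ is the set of real full-column-rank $n\times k$ matrices $V$ with $V^{\tau}MV=N$. $(A,B,C)$ denotes the LTI system $\dot x=Ax+Bu$, $y=Cx$. It is asymptotically stable if for every initial condition the solution of $\dot x=Ax$ is bounded for $t\ge 0$ and tends to $0$ as $t\to\infty$ (equivalently, all eigenvalues of $A$ have strictly negative real part). *)

(* Defs.v *)
From mathcomp Require Import all_boot all_order all_algebra.
From mathcomp Require Import all_classical all_reals all_analysis.
Import Order.TTheory GRing.Theory Num.Theory.
Import numFieldNormedType.Exports.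

Set Implicit Arguments.
Unset Strict Implicit.
Unset Printing Implicit Defensive.

Local Open Scope classical_set_scope.
Local Open Scope ring_scope.

Definition posdef_mx (R : realType) (n : nat) (X : 'M[R]_n) : Prop :=
  X^T = X /\ forall v : 'cV[R]_n, v != 0 -> 0 < (v^T *m X *m v) 0 0.

Definition negdef_mx (R : realType) (n : nat) (X : 'M[R]_n) : Prop :=
  X^T = X /\ forall v : 'cV[R]_n, v != 0 -> (v^T *m X *m v) 0 0 < 0.

Definition SPD (R : realType) (n : nat) : set 'M[R]_n :=
  [set X | posdef_mx X].
Arguments SPD : clear implicits.

(* O(M, N); [\rank V = k] is full column rank, as V has k columns. *)
Definition Oset (R : realType) (n k : nat) (M : 'M[R]_n) (N : 'M[R]_k) :
    set 'M[R]_(n, k) :=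
  [set V | \rank V = k /\ V^T *m M *m V = N].

(* The system x' = A x + B u, y = C x, with n states, p inputs, q outputs. *)
Record lti (R : realType) (n p q : nat) := LTI {
  ltiA : 'M[R]_n;
  ltiB : 'M[R]_(n, p);
  ltiC : 'M[R]_(q, n)
}.

(* A solution on [0, +oo[ only: values of x at negative times are irrelevant.
   At t = 0 continuity from the right is required; together with the equation
   for t > 0 it gives the equation for the right derivative at 0. *)
Definition lti_free_solution (R : realType) (n p q : nat) (S : lti R n p q)
    (x0 : 'cV[R]_n) (x : R -> 'cV[R]_n) : Prop :=
  [/\ x 0 = x0,
      {within `[0, +oo[, continuous x} &
      forall t : R, 0 < t -> is_derive t 1 x (ltiA S *m x t)].

Definition asymptotically_stable (R : realType) (n p q : nat)
    (S : lti R n p q) : Prop :=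
  forall (x0 : 'cV[R]_n) (x : R -> 'cV[R]_n), lti_free_solution S x0 x ->
    [bounded x t | t in `[0, +oo[] /\ x t @[t --> +oo] --> (0 : 'cV[R]_n).

Definition ipp_Psi (R : realType) (n k : nat) (M : 'M[R]_n) (N : 'M[R]_k)
    (Phi : 'M[R]_(n, k)) : 'M[R]_(n, k) :=
  M *m Phi *m invmx N.

(* The reduced-order model of S obtained by inner-product projection. *)
Definition ipp_rom (R : realType) (n k p q : nat) (M : 'M[R]_n) (N : 'M[R]_k)
    (Phi : 'M[R]_(n, k)) (S : lti R n p q) : lti R k p q :=
  let Psi := ipp_Psi M N Phi in
  LTI (Psi^T *m ltiA S *m Phi) (Psi^T *m ltiB S) (ltiC S *m Phi).

(* Main.v *)
(* Since N Psi^T = Phi^T Theta, the reduced Lyapunov expression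
   At^T N + N At is the congruence Phi^T (A^T Theta + Theta A) Phi, which is
   negative definite because Phi is injective. Stability then follows from the
   Lyapunov function V(t) = x(t)^T N x(t): with Q = At^T N + N At one has
   N <= - L Q as quadratic forms for some L > 0, so V' <= - V / L and V decays
   exponentially. The comparison of quadratic forms uses no compactness: by
   Cauchy-Schwarz, v_i^2 <= (P^-1)_ii v^T P v for positive definite P. *)
Require Import Defs.
From mathcomp Require Import all_boot all_order all_algebra.
From mathcomp Require Import all_classical all_reals all_analysis.
From mathcomp Require Import ring lra.
Import Order.TTheory GRing.Theory Num.Theory.
Import numFieldNormedType.Exports.

Set Implicit Arguments.
Unset Strict Implicit.
Unset Printing Implicit Defensive.

Local Open Scope classical_set_scope.
Local Open Scope ring_scope.

(** * Quadratic forms and definiteness *)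

Definition quad_form (R : realType) (n : nat) (X : 'M[R]_n) (v : 'cV[R]_n) :
    R :=
  (v^T *m X *m v) 0 0.

Lemma quad_formE (R : realType) (n : nat) (X : 'M[R]_n) (v : 'cV[R]_n) :
  quad_form X v = \sum_j \sum_i v i 0 * X i j * v j 0.
Proof.
rewrite /quad_form mxE; apply: eq_bigr => j _.
by rewrite mxE mulr_suml; apply: eq_bigr => i _; rewrite mxE.
Qed.

Lemma quad_formN (R : realType) (n : nat) (X : 'M[R]_n) (v : 'cV[R]_n) :
  quad_form (- X) v = - quad_form X v.
Proof. by rewrite /quad_form mulmxN mulNmx mxE. Qed.

Lemma quad_form_congr (R : realType) (n k : nat) (X : 'M[R]_n)
    (V : 'M[R]_(n, k)) (v : 'cV[R]_k) :
  quad_form (V^T *m X *m V) v = quad_form X (V *m v).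
Proof. by rewrite /quad_form trmx_mul !mulmxA. Qed.

Lemma posdef_mx_ge0 (R : realType) (n : nat) (X : 'M[R]_n) (v : 'cV[R]_n) :
  posdef_mx X -> 0 <= quad_form X v.
Proof.
move=> [_ X_gt0]; have [->|v0] := eqVneq v 0; last exact/ltW/X_gt0.
by rewrite /quad_form mulmx0 mxE.
Qed.

Lemma negdef_mxN (R : realType) (n : nat) (X : 'M[R]_n) :
  negdef_mx X -> posdef_mx (- X).
Proof.
move=> [Xsym X_lt0]; split=> [|v v0]; first by rewrite raddfN /= Xsym.
by have := quad_formN X v; rewrite /quad_form => ->; rewrite oppr_gt0 X_lt0.
Qed.

(** * Bounds between norms and quadratic forms *)

Lemma posdef_unitmx (R : realType) (n : nat) (X : 'M[R]_n) :
  posdef_mx X -> X \in unitmx.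
Proof.
move=> [_ X_gt0]; rewrite -row_free_unit -kermx_eq0; apply/eqP/row_matrixP => i.
rewrite row0; set u := row i _.
have uX : u *m X = 0 by apply/sub_kermxP; rewrite row_sub.
(* A nonzero [u] in the left kernel would give [u X u^T = 0], against positivity at [u^T]. *)
apply/eqP/negPn/negP => u0.
have := X_gt0 u^T; rewrite trmxK uX mul0mx mxE ltxx => /(_ _)/notF; apply.
by apply: contra_neq u0 => /(congr1 trmx); rewrite trmxK trmx0.
Qed.

(* Cauchy-Schwarz for the inner product of P, applied to v and P^-1 e_i. *)
Lemma posdef_coord_le (R : realType) (n : nat) (P : 'M[R]_n) (i : 'I_n)
    (v : 'cV[R]_n) :
  posdef_mx P -> v i 0 ^+ 2 <= invmx P i i * quad_form P v.
Proof.
move=> Ppos; have [Psym P_gt0] := Ppos; have Punit := posdef_unitmx Ppos.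
pose e : 'cV[R]_n := delta_mx i 0; pose w := invmx P *m e.
have Pw : P *m w = e by rewrite mulmxA mulmxV ?mul1mx.
have wP : w^T *m P = e^T by rewrite -[in LHS]Psym -trmx_mul Pw.
have eu (u : 'cV[R]_n) : (e^T *m u) 0 0 = u i 0.
  by rewrite trmx_delta -rowE mxE.
have ue (u : 'cV[R]_n) : (u^T *m e) 0 0 = u i 0.
  by rewrite -colE !mxE.
have wi : w i 0 = invmx P i i by rewrite /w -colE mxE.
have adde (X Y : 'M[R]_1) : (X + Y) 0 0 = X 0 0 + Y 0 0 by rewrite mxE.
have scale (a : R) (X : 'M[R]_1) : (a *: X) 0 0 = a * X 0 0 by rewrite mxE.
have expand t : quad_form P (v + t *: w) =
    quad_form P v + t * v i 0 *+ 2 + t ^+ 2 * invmx P i i.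
  rewrite /quad_form [(v + _)^T]raddfD /= [trmx (t *: w)]linearZ /=.
  rewrite !mulmxDl -!scalemxAl wP !mulmxDr.
  rewrite -!scalemxAr -[v^T *m P *m w]mulmxA Pw.
  by rewrite !(adde, scale, eu, ue) wi; ring.
have w_neq0 : w != 0.
  apply/eqP => w0; have := congr1 (fun u : 'cV[R]_n => u i 0) Pw.
  by rewrite w0 mulmx0 !mxE !eqxx => /esym/eqP; rewrite oner_eq0.
have c_gt0 : 0 < invmx P i i.
  by have := P_gt0 w w_neq0; rewrite wP eu wi.
(* The parameter minimises the quadratic polynomial of [expand]; multiplying its nonnegative minimum
   by [invmx P i i] gives exactly the required difference. *)
have := posdef_mx_ge0 (v + (- (v i 0 / invmx P i i)) *: w) Ppos.
rewrite expand => h; rewrite -subr_ge0.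
have -> : invmx P i i * quad_form P v - v i 0 ^+ 2 = invmx P i i *
    (quad_form P v + - (v i 0 / invmx P i i) * v i 0 *+ 2 +
     (- (v i 0 / invmx P i i)) ^+ 2 * invmx P i i).
  by field; rewrite gt_eqF.
by rewrite mulr_ge0// ltW.
Qed.

(** The norm is the largest absolute value of an entry, so for [v != 0] it is attained at some
    coordinate, and the coordinate bound applies there. The sum in [K] dominates every diagonal
    entry of [invmx P]; the added 1 keeps [K] positive even when [n = 0]. *)
Lemma posdef_norm_le (R : realType) (n : nat) (P : 'M[R]_n) :
  posdef_mx P ->
  exists2 K, 0 < K & forall v : 'cV[R]_n, `|v| ^+ 2 <= K * quad_form P v.
Proof.
move=> Ppos; exists (1 + \sum_i `|invmx P i i|) => [|v].
  by rewrite ltr_pwDl// sumr_ge0.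
have qv := posdef_mx_ge0 v Ppos.
have K_ge0 : 0 <= 1 + \sum_i `|invmx P i i| by rewrite addr_ge0// sumr_ge0.
have [->|v0] := eqVneq v 0.
  by rewrite normr0 expr0n mulr_ge0// posdef_mx_ge0.
have [[i j] ->] : exists ij, `|v| = `|v ij.1 ij.2|.
  by apply: mx_norm_neq0; rewrite -[mx_norm v]/(`|v|) normr_eq0.
rewrite /= ord1 real_normK ?num_real// (le_trans (posdef_coord_le _ _ Ppos))//.
apply: ler_wpM2r => //; rewrite (le_trans (ler_norm _))// (bigD1 i)//= addrCA.
by rewrite lerDl addr_ge0// sumr_ge0.
Qed.

Lemma mx_coord_le_norm (R : realType) (m n : nat) (X : 'M[R]_(m, n)) i j :
  `|X i j| <= `|X|.
Proof.
rewrite [leRHS]/Num.Def.normr /= mx_normrE.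
exact: (le_bigmax _ (fun ij => `|X ij.1 ij.2|) (i, j)).
Qed.

Lemma quad_form_le_norm (R : realType) (n : nat) (X : 'M[R]_n) (v : 'cV[R]_n) :
  quad_form X v <= (\sum_j \sum_i `|X i j|) * `|v| ^+ 2.
Proof.
rewrite quad_formE mulr_suml ler_sum// => j _.
rewrite mulr_suml ler_sum// => i _.
rewrite (le_trans (ler_norm _))// !normrM mulrAC mulrC ler_wpM2l//.
by rewrite expr2 ler_pM ?mx_coord_le_norm.
Qed.

Lemma posdef_quad_form_le (R : realType) (n : nat) (X P : 'M[R]_n) :
  posdef_mx P ->
  exists2 L, 0 < L & forall v, quad_form X v <= L * quad_form P v.
Proof.
move=> Ppos; have [K K_gt0 hK] := posdef_norm_le Ppos.
set S := \sum_j \sum_i `|X i j|.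
have S_ge0 : 0 <= S by rewrite sumr_ge0// => j _; rewrite sumr_ge0.
(* [S] alone would vanish for [X = 0], and the constant has to be positive. *)
exists ((1 + S) * K) => [|v]; first by rewrite mulr_gt0// ltr_pwDl.
rewrite (le_trans (quad_form_le_norm _ _))// -mulrA -/S.
rewrite ler_pM ?exprn_ge0 ?lerDr//.
Qed.

(** * Continuity, and the derivative along a trajectory *)

Lemma quad_form_continuous (R : realType) (n : nat) (X : 'M[R]_n) :
  continuous (quad_form X).
Proof.
move=> v; rewrite /continuous_at quad_formE.
rewrite (_ : quad_form X = fun u =>
    \sum_j \sum_i u i 0 * X i j * u j 0); last first.
  by apply/funext => u; rewrite quad_formE.
apply: cvg_big => [||j _]; [exact: add_continuous|exact: nbhs_filter|].
apply: cvg_big => [||i _]; [exact: add_continuous|exact: nbhs_filter|].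
apply: (@cvgM _ _ (nbhs v)); last exact: coord_continuous.
apply: (@cvgMr_tmp _ _ (nbhs v)); exact: coord_continuous.
Qed.

Lemma is_derive_coord (R : realType) (m n : nat) (x : R -> 'M[R]_(m, n))
    (d : 'M[R]_(m, n)) (t : R) i j :
  is_derive t 1 x d -> is_derive t 1 (fun s => x s i j) (d i j).
Proof.
move=> [dx xd]; split; first exact: ((derivable_mxP x t 1).1 dx).
by rewrite -xd derive_mx// mxE.
Qed.

Lemma is_derive_quad_form (R : realType) (n : nat) (A P : 'M[R]_n)
    (x : R -> 'cV[R]_n) (t : R) :
  is_derive t 1 x (A *m x t) ->
  is_derive t 1 (quad_form P \o x) (quad_form (A^T *m P + P *m A) (x t)).
Proof.
move=> dx.
(* Written as a sum of products of coordinate functions, the form can be differentiated termwise by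
   the product rule. *)
rewrite (_ : quad_form P \o x =
  \sum_j \sum_i ((fun s => x s i 0) * cst (P i j) * (fun s => x s j 0)));
  last first.
  apply/funext => s /=; rewrite quad_formE fct_sumE; apply: eq_bigr => j _.
  by rewrite fct_sumE.
have dxi i := is_derive_coord i 0 dx.
pose y := A *m x t.
have -> : quad_form (A^T *m P + P *m A) (x t) =
  \sum_j \sum_i (x t i 0 * P i j * y j 0 + x t j 0 * (P i j * y i 0)).
  (* The two summands are the two halves of the product rule for [x^T P x], with [y] the derivative
     of [x]. *)
  have -> : quad_form (A^T *m P + P *m A) (x t) =
     ((x t)^T *m P *m y) 0 0 + (y^T *m P *m x t) 0 0.
    by rewrite /quad_form /y trmx_mul mulmxDr mulmxDl mxE addrC !mulmxA.
  rewrite !mxE -big_split; apply: eq_bigr => j _ /=.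
  rewrite !mxE !mulr_suml -big_split; apply: eq_bigr => i _ /=.
  by rewrite !mxE; ring.
apply: is_derive_sum => j; apply: is_derive_sum => i.
apply: is_derive_eq.
by rewrite /= /y scaler0 add0r.
Qed.

(** * Exponential decay and stability *)

Lemma lyapunov_decay (R : realType) (n p q : nat) (S : lti R n p q)
    (P : 'M[R]_n) :
  posdef_mx P -> negdef_mx ((ltiA S)^T *m P + P *m ltiA S) ->
  exists K L : R, [/\ 0 < K, 0 < L &
    forall x0 x, lti_free_solution S x0 x -> forall t, 0 <= t ->
      `|x t| ^+ 2 <= K * quad_form P x0 * expR (- (L^-1 * t))].
Proof.
move=> Ppos /negdef_mxN; set Q := _ + _ => Qpos.
have [K K_gt0 hK] := posdef_norm_le Ppos.
have [L L_gt0 hL] := posdef_quad_form_le P Qpos.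
exists K, L; split=> // _ x [<- cx dx] t t_ge0.
pose V := quad_form P \o x.
(* Integrating factor: [V' <= - V / L] says that [exp(t / L) V(t)] is nonincreasing. *)
pose g : R -> R := (expR \o ( *%R L^-1)) * V.
have dg (s : R) : 0 < s ->
    is_derive s 1 g (expR (L^-1 * s) * (L^-1 * V s + quad_form Q (x s))).
  move=> /dx/(@is_derive_quad_form _ _ _ P) dV.
  have dE : is_derive s 1 ( *%R L^-1 : R -> R) L^-1.
    have -> : ( *%R L^-1 : R -> R) = L^-1 \*: id by [].
    by apply: is_derive_eq; rewrite /GRing.scale /= mulr1.
  apply: is_derive_eq.
  by rewrite -/(V s) /GRing.scale /= -/Q; ring.
have cg : {within `[0, t], continuous g}.
  have cV : {within `[0, t], continuous V}.
    apply: within_continuous_comp.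
      by move=> v _; exact: quad_form_continuous.
    by apply: continuous_subspaceW cx; exact: subset_itvl.
  have cE : {within `[0, t], continuous (expR \o ( *%R L^-1))}.
    apply: continuous_subspaceT => s.
    apply: continuous_comp; last exact: continuous_expR.
    exact: mulrl_continuous.
  by move=> s; apply: continuousM; [exact: cE|exact: cV].
have gle : g t <= g 0.
  (* Derivatives are needed only on the open interval, where the equation holds; the endpoint 0 is
     covered by one-sided continuity. *)
  apply: (ler0_derive1_le_cc _ _ cg) => //; rewrite ?in_itv/= ?lexx ?t_ge0//.
    by move=> s /[!in_itv]/= /andP[/dg[]].
  move=> s /[!in_itv]/= /andP[/dg[_]] + _; rewrite derive1E => ->.
  (* The exponential factor is positive, so the sign is that of [V / L] plus the form of [Q], which
     [hL] makes nonpositive. *)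
  rewrite pmulr_rle0 ?expR_gt0//.
  have := hL (x s); rewrite quad_formN -ler_pdivrMl//.
  by rewrite -lerBrDr sub0r.
rewrite (le_trans (hK _))// -mulrA ler_wpM2l ?(ltW K_gt0)//.
rewrite expRN ler_pdivlMr ?expR_gt0// mulrC (le_trans gle)//.
by rewrite /g /= mulrfctE /= mulr0 expR0 mul1r.
Qed.

Lemma lyapunov_stable (R : realType) (n p q : nat) (S : lti R n p q)
    (P : 'M[R]_n) :
  posdef_mx P -> negdef_mx ((ltiA S)^T *m P + P *m ltiA S) ->
  asymptotically_stable S.
Proof.
move=> Ppos /(lyapunov_decay Ppos)[K [L [K_gt0 L_gt0 decay]]] x0 x Sx.
set D := K * quad_form P x0 in decay.
have D_ge0 : 0 <= D by rewrite mulr_ge0 ?posdef_mx_ge0// ltW.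
split.
  exists (1 + D); split=> [|M ltM t /= /[!in_itv]/= /[!andbT] t_ge0].
    exact: num_real.
  have xt : `|x t| ^+ 2 <= D.
    rewrite (le_trans (decay _ _ Sx _ t_ge0))// ler_piMr// -expR0 ler_expR.
    by rewrite oppr_le0 mulr_ge0// invr_ge0 ltW.
  (* If [|x t|] exceeded [M > 1 + D], it would be above 1, so its square would exceed it and hence
     [D]. The bound [1 + D] thus avoids a square root. *)
  have := normr_ge0 (x t); nra.
have cvgE : D * expR (- (L^-1 * t)) @[t --> +oo] --> D * 0.
  apply: cvgM; first exact: cvg_cst.
  have Lt : L^-1 * t @[t --> +oo] --> +oo.
    by apply: gt0_cvgMry; rewrite ?invr_gt0//; exact: cvg_id.
  exact: cvg_comp Lt (@cvgr_expR R).
apply/cvgr0Pnorm_lt => e e_gt0.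
(* The decay estimate controls the squared norm, so the tolerance is squared too. *)
move: cvgE; rewrite mulr0 => /cvgr0Pnorm_lt /(_ (e ^+ 2)).
rewrite exprn_gt0// => /(_ isT) hE; near=> t.
rewrite -(@ltr_pXn2r _ 2)// ?nnegrE ?(ltW e_gt0)//.
apply: le_lt_trans (decay _ _ Sx t _) _ => //.
apply: le_lt_trans (ler_norm _) _.
near: t; exact: hE.
Unshelve. all: by end_near. Qed.

(** * Transfer to the reduced-order model *)

Lemma full_col_rank_mul_eq0 (R : fieldType) (n k : nat) (V : 'M[R]_(n, k))
    (v : 'cV[R]_k) :
  \rank V = k -> V *m v = 0 -> v = 0.
Proof.
move=> rV Vv0; have : row_free V^T by rewrite /row_free mxrank_tr rV.
(* A right inverse [W] of [V^T] transposes to a left inverse of [V]. *)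
move=> /row_freeP[W VW]; have := congr1 trmx VW; rewrite trmx_mul trmxK trmx1.
by move=> WV; rewrite -[v]mul1mx -WV -mulmxA Vv0 mulmx0.
Qed.

Lemma ipp_rom_lyapunov (R : realType) (n p q k : nat) (S : lti R n p q)
    (Theta : 'M[R]_n) (N : 'M[R]_k) (Phi : 'M[R]_(n, k)) :
  Theta^T = Theta -> posdef_mx N ->
  let rom := ipp_rom Theta N Phi S in
  (ltiA rom)^T *m N + N *m ltiA rom =
  Phi^T *m ((ltiA S)^T *m Theta + Theta *m ltiA S) *m Phi.
Proof.
move=> Tsym Npos; rewrite /ipp_rom /=; have [Nsym _] := Npos.
have NA : N *m ((ipp_Psi Theta N Phi)^T *m ltiA S *m Phi) =
    Phi^T *m Theta *m ltiA S *m Phi.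
  rewrite /ipp_Psi !trmx_mul Tsym trmx_inv Nsym !mulmxA.
  by rewrite mulmxV ?posdef_unitmx// mul1mx.
(* This is the transpose of [NA], by symmetry of [N] and [Theta]. *)
have AN : ((ipp_Psi Theta N Phi)^T *m ltiA S *m Phi)^T *m N =
    Phi^T *m (ltiA S)^T *m Theta *m Phi.
  by apply: trmx_inj; rewrite trmx_mul trmxK Nsym NA !trmx_mul !trmxK Tsym
     !mulmxA.
by rewrite NA AN mulmxDr mulmxDl !mulmxA.
Qed.

Theorem lemma3p8 (R : realType) (n p q k : nat)
    (A : 'M[R]_n) (B : 'M[R]_(n, p)) (C : 'M[R]_(q, n))
    (Theta : 'M[R]_n) (N : 'M[R]_k) (Phi : 'M[R]_(n, k))
    (hTheta : SPD R n Theta)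
    (hLyap : negdef_mx (A^T *m Theta + Theta *m A))
    (hkn : (k <= n)%N)
    (hN : SPD R k N)
    (hPhi : Oset Theta N Phi) :
  let rom := ipp_rom Theta N Phi (LTI A B C) in
  negdef_mx ((ltiA rom)^T *m N + N *m ltiA rom) /\
  asymptotically_stable rom.
Proof.
have [Tsym _] := hTheta.
have [rPhi _] := hPhi.
have lyap : negdef_mx ((ltiA (ipp_rom Theta N Phi (LTI A B C)))^T *m N +
    N *m ltiA (ipp_rom Theta N Phi (LTI A B C))).
  rewrite ipp_rom_lyapunov//=; have [Lsym L_lt0] := hLyap; split.
    by rewrite !trmx_mul trmxK Lsym mulmxA.
  move=> v v0; rewrite -/(quad_form _ v) quad_form_congr; apply: L_lt0.
  by apply: contra_neq v0; exact: full_col_rank_mul_eq0.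
split; [exact: lyap|exact: lyapunov_stable hN lyap].
Qed.
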